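(* If $G$ is an infinite connected graph and $d$ is a (finite) positive integer, then $\mathrm{gp}_d(G)=\infty$.
   Context: Graphs are simple and undirected; $G$ is infinite if $V(G)$ is infinite. $d_G(u,w)$ denotes the shortest-path distance in $G$, and $I_G(u,w)=\{x\in V(G): d_G(u,w)=d_G(u,x)+d_G(x,w)\}$. A set $S\subseteq V(G)$ is a general $d$-position set if for any three distinct vertices $u,v,w\in S$ with $v\in I_G(u,w)$ we have $d_G(u,w)>d$. $\mathrm{gp}_d(G)$ is the cardinality of a largest general $d$-position set of $G$; $\mathrm{gp}_d(G)=\infty$ means that $G$ contains an infinite general $d$-position set. *)

(* Defs.v *)
From mathcomp Require Import all_boot.
From mathcomp Require Import boolp classical_sets functions cardinality.
Set Implicit Arguments.
Unset Strict Implicit.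
Unset Printing Implicit Defensive.
Local Open Scope classical_set_scope.

(* The vertex type is arbitrary, possibly infinite; decidable equality is no
   restriction classically (see boolp). *)
Record sgraph := SGraph {
  vertex :> eqType;
  adj : rel vertex;
  adj_sym : symmetric adj;
  adj_irrefl : irreflexive adj }.

Definition infinite_graph (G : sgraph) : Prop := infinite_set [set: G].

(* The path visits u :: p in this order, so that size p is its length. *)
Definition is_path (G : sgraph) (u w : G) (p : seq G) : bool :=
  [&& path (@adj G) u p, last u p == w & uniq (u :: p)].

Definition connected_graph (G : sgraph) : Prop :=
  forall u w : G, exists p, is_path u w p.

Definition path_length (G : sgraph) (u w : G) (n : nat) : bool :=
  `[< exists2 p, is_path u w p & size p = n >].

(* The value is 0 by convention when no path joins u and w, which does not
   happen in a connected graph. *)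
Definition dist (G : sgraph) (u w : G) : nat :=
  if pselect (exists n, path_length u w n) is left exn then ex_minn exn else 0.

Definition interval (G : sgraph) (u w : G) : set G :=
  [set x | dist u w = dist u x + dist x w].

Definition general_position (d : nat) (G : sgraph) (S : set G) : Prop :=
  forall u v w : G, S u -> S v -> S w -> u <> v -> v <> w -> u <> w ->
    interval u w v -> d < dist u w.

(* gp_d(G) = oo: an infinite general d-position set exists, which is stronger
   than having finite ones of unbounded cardinality. *)
Definition gp_infinite (d : nat) (G : sgraph) : Prop :=
  exists2 S : set G, infinite_set S & general_position d S.

(* Main.v *)
Require Import Defs.
From mathcomp Require Import all_boot.
From mathcomp Require Import boolp classical_sets cardinality.

(** The theorem is an instance of the infinite Ramsey theorem
    ([infinite_ramsey]).  Colour each pair of vertices by its distance, with all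
    the distances greater than [d] merged into one colour; this uses finitely
    many colours, so some infinite set [S] of vertices is monochromatic.  Either
    all the distances within [S] exceed [d], and [S] is a general [d]-position
    set at once; or they are all equal to one number [k], and then [v] between
    [u] and [w] would give [k = k + k], whereas [k > 0] because distinct vertices
    of a connected graph are at positive distance ([dist_gt0]).

    This treats uniformly the two cases that one might distinguish: around a
    vertex of infinite degree Ramsey yields an infinite clique or an infinite
    set of vertices at mutual distance 2, while in a locally finite graph one
    can find infinitely many vertices that are pairwise far apart. *)

Local Open Scope classical_set_scope.

(** * The infinite Ramsey theorem for pairs *)

Lemma infinite_pigeonhole {T : Type} {C : finType} (g : T -> C) {A : set T} :
  infinite_set A -> exists c, infinite_set (A `&` [set x | g x = c]).
Proof.
move=> Ainf; apply: contrapT => /forallNP fibre_fin; apply: Ainf.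
have -> : A = \bigcup_(c in [set: C]) (A `&` [set x | g x = c]).
  by apply/seteqP; split=> [x Ax | x [c _ []] //]; exists (g x).
apply: bigcup_finite => [|c _]; first exact: finite_finset.
exact: contrapT (fibre_fin c).
Qed.

(** One step of the construction of a sequence [a] such that the colour of the
    pair [a m, a n], for [m < n], depends on [m] only: all the later terms are
    to be taken from [B]. *)
Lemma ramsey_step {T : Type} {C : finType} (f : T -> T -> C) {A : set T} :
  infinite_set A -> exists a c (B : set T),
    [/\ A a, ~ B a, B `<=` A, infinite_set B & forall x, B x -> f a x = c].
Proof.
move=> Ainf; have [a Aa] := infinite_setN0 Ainf.
have [c Binf] :=
  infinite_pigeonhole (f a) (infinite_setD Ainf (finite_set1 a)).
exists a, c, ((A `\ a) `&` [set x | f a x = c]).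
by split=> // [[[_ /(_ erefl)]] | x [[]] | x []].
Qed.

(** Iterating [ramsey_step] gives a sequence of distinct points in which the
    colour of a pair is decided by its earlier member; the pigeonhole principle
    then selects infinitely many indices that decide for the same colour. *)
Theorem infinite_ramsey {T : Type} {C : finType} (f : T -> T -> C) (A : set T) :
    (forall x y, f x y = f y x) -> infinite_set A ->
  exists S c, [/\ S `<=` A, infinite_set S &
    forall x y, S x -> S y -> x <> y -> f x y = c].
Proof.
move=> fC Ainf.
have /choice[step stepP] : forall X : {X : set T | infinite_set X},
    exists s : T * C * {X : set T | infinite_set X},
      [/\ sval X s.1.1, ~ sval s.2 s.1.1, sval s.2 `<=` sval X &
          forall x, sval s.2 x -> f s.1.1 x = s.1.2].
  move=> [X Xinf]; have [a [c [B [Xa NBa BX Binf fB]]]] := ramsey_step f Xinf.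
  by exists (a, c, exist _ B Binf).
pose X n := iter n (fun X => (step X).2) (exist _ A Ainf).
pose a n := (step (X n)).1.1; pose col n := (step (X n)).1.2.
have Xanti m n : m <= n -> sval (X n) `<=` sval (X m).
  move/subnK <-; elim: (n - m) => [//|k IHk] x Xx.
  by apply: IHk; have [_ _ + _] := stepP (X (k + m)); apply.
have Xa n : sval (X n) (a n) by have [] := stepP (X n).
have a_later m n : m < n -> sval (X m.+1) (a n).
  by move=> lt_mn; apply: (Xanti _ _ lt_mn).
have a_neq m n : m < n -> a m <> a n.
  move=> lt_mn eq_a; have [_ NXa _ _] := stepP (X m).
  by apply: NXa; rewrite -/(a m) eq_a; exact: a_later lt_mn.
have a_inj : injective a.
  by move=> m n eq_a; case: (ltngtP m n) => // /a_neq; rewrite eq_a.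
have f_a m n : m < n -> f (a m) (a n) = col m.
  by move=> lt_mn; have [_ _ _ ->] := stepP (X m); last exact: a_later.
have [c Iinf] := infinite_pigeonhole col infinite_nat.
exists (a @` ([set: nat] `&` [set n | col n = c])), c; split.
- by move=> _ [n _ <-]; apply: (Xanti 0 n).
- by rewrite (eq_finite_set (inj_card_eq (in2W a_inj))).
move=> _ _ [m [_ cm] <-] [n [_ cn] <-] neq_a.
case: (ltngtP m n) => [/f_a-> | /f_a | eq_mn]; first exact: cm.
  by rewrite fC => ->.
by case: neq_a; rewrite eq_mn.
Qed.

(** * Distances in a graph *)

Lemma is_path_rev {G : sgraph} {u w : G} {p : seq G} :
  is_path u w p -> is_path w u (rev (belast u p)).
Proof.
case/and3P=> path_p /eqP last_p uniq_p; rewrite /is_path -{1}last_p rev_path.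
have rev_p : w :: rev (belast u p) = rev (u :: p).
  by rewrite (lastI u) last_p rev_rcons.
apply/and3P; split; last by rewrite rev_p rev_uniq.
  by rewrite (eq_path (e' := @adj G)) // => x y; exact: adj_sym.
have -> : last w (rev (belast u p)) = last w (rev (u :: p)) by rewrite -rev_p.
by rewrite rev_cons last_rcons.
Qed.

Lemma path_lengthC {G : sgraph} (u w : G) : path_length u w = path_length w u.
Proof.
apply/funext => n; apply/asboolP/asboolP => -[p /is_path_rev rev_p size_p];
  by eexists; [exact: rev_p | rewrite size_rev size_belast].
Qed.

Lemma distC {G : sgraph} (u w : G) : dist u w = dist w u.
Proof. by rewrite /dist path_lengthC. Qed.

Lemma dist_gt0 {G : sgraph} {u w : G} :
  connected_graph G -> u <> w -> 0 < dist u w.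
Proof.
move=> Gconn neq_uw; rewrite /dist; case: pselect => [ex_len | []]; last first.
  by have [p uwp] := Gconn u w; exists (size p); apply/asboolP; exists p.
case: ex_minnP => -[|//] /asboolP[p /and3P[_ /eqP last_p _] /size0nil p0] _.
by case: neq_uw; rewrite p0 in last_p.
Qed.

(** * General position *)

Theorem proposition6p1 (G : sgraph) (d : nat)
    (Ginf : infinite_graph G) (Gconn : connected_graph G) (d_gt0 : 0 < d) :
  gp_infinite d G.
Proof.
(* The top colour [d.+1] stands for all the distances greater than [d]. *)
pose colour (u w : G) : 'I_d.+2 := inord (minn (dist u w) d.+1).
have colourE u w : colour u w = minn (dist u w) d.+1 :> nat.
  by rewrite inordK // ltnS geq_minr.
have colourC u w : colour u w = colour w u by rewrite /colour distC.
have [S [c [_ Sinf Sc]]] := infinite_ramsey colour setT colourC Ginf.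
exists S => // u v w Su Sv Sw neq_uv neq_vw neq_uw uwv.
rewrite ltnNge; apply/negP => le_uw_d.
have dist_c x y : S x -> S y -> x <> y -> minn (dist x y) d.+1 = dist u w.
  move=> Sx Sy neq_xy; rewrite -colourE (Sc x y) // -(Sc u w) // colourE.
  by apply/minn_idPl/leqW.
have dist_eq x y : S x -> S y -> x <> y -> dist x y = dist u w.
  move=> Sx Sy neq_xy; have := dist_c x y Sx Sy neq_xy.
  case: (leqP (dist x y) d.+1) => // _ eq_d.
  by move: le_uw_d; rewrite -eq_d ltnn.
have := dist_gt0 Gconn neq_uw; move: uwv; rewrite /interval /=.
rewrite (dist_eq u v) // (dist_eq v w) // => /eqP.
by rewrite -{1}[dist u w]addn0 eqn_add2l => /eqP <-.
Qed.
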